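(* Let $X$ be a complex Banach space of dimension at least $2$, and let $\mathcal S\subseteq\mathcal B(X)$ be a multiplicative semigroup such that $\operatorname{rank}[S,T]\le 1$ for all $S,T\in\mathcal S$. Suppose that $A,B\in\mathcal S$ satisfy $[A,B]=y\otimes\phi$ for some non-zero vector $y\in X$ and some non-zero functional $\phi\in X^*$. Then $\phi(Cy)=0$ for every $C\in\mathcal S\cup\{I\}$.
   Context: $\mathcal B(X)$ is the algebra of bounded linear operators on $X$ and $I$ is the identity operator. A semigroup is a subset of $\mathcal B(X)$ closed under multiplication. $[S,T]=ST-TS$. For $y\in X$ and $\phi\in X^*$, $y\otimes\phi$ denotes the operator $x\mapsto\phi(x)y$. *)

(* Defs.v *)
From Stdlib Require Import Reals.
Open Scope R_scope.

Record Cplx : Type := mkC { Re : R ; Im : R }.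

Definition C0 : Cplx := mkC 0 0.
Definition C1 : Cplx := mkC 1 0.
Definition Cadd (a b : Cplx) : Cplx := mkC (Re a + Re b) (Im a + Im b).
Definition Cmul (a b : Cplx) : Cplx :=
  mkC (Re a * Re b - Im a * Im b) (Re a * Im b + Im a * Re b).
Definition Cmod (a : Cplx) : R := sqrt (Re a * Re a + Im a * Im a).

Record CBanach : Type := {
  carrier :> Type ;
  vzero : carrier ;
  vadd : carrier -> carrier -> carrier ;
  vopp : carrier -> carrier ;
  vscal : Cplx -> carrier -> carrier ;
  vnorm : carrier -> R ;
  vadd_assoc : forall x y z, vadd x (vadd y z) = vadd (vadd x y) z ;
  vadd_comm : forall x y, vadd x y = vadd y x ;
  vadd_0l : forall x, vadd vzero x = x ;
  vadd_oppr : forall x, vadd x (vopp x) = vzero ;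
  vscal_assoc : forall a b x, vscal a (vscal b x) = vscal (Cmul a b) x ;
  vscal_1 : forall x, vscal C1 x = x ;
  vscal_addr : forall a x y, vscal a (vadd x y) = vadd (vscal a x) (vscal a y) ;
  vscal_addl : forall a b x, vscal (Cadd a b) x = vadd (vscal a x) (vscal b x) ;
  vnorm_ge0 : forall x, 0 <= vnorm x ;
  vnorm_eq0 : forall x, vnorm x = 0 -> x = vzero ;
  vnorm_triangle : forall x y, vnorm (vadd x y) <= vnorm x + vnorm y ;
  vnorm_scal : forall a x, vnorm (vscal a x) = Cmod a * vnorm x ;
  complete : forall u : nat -> carrier,
    (forall eps, 0 < eps -> exists N, forall m n, (N <= m)%nat -> (N <= n)%nat ->
        vnorm (vadd (u m) (vopp (u n))) < eps) ->
    exists l, forall eps, 0 < eps -> exists N, forall n, (N <= n)%nat ->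
        vnorm (vadd (u n) (vopp l)) < eps
}.

Arguments vzero {X} : rename.
Arguments vadd {X} : rename.
Arguments vopp {X} : rename.
Arguments vscal {X} : rename.
Arguments vnorm {X} : rename.

Definition vsub {X : CBanach} (x y : X) : X := vadd x (vopp y).

Definition dim_ge2 (X : CBanach) : Prop :=
  exists u v : X, forall a b : Cplx,
    vadd (vscal a u) (vscal b v) = vzero -> a = C0 /\ b = C0.

Definition is_linear_op {X : CBanach} (T : X -> X) : Prop :=
  (forall x y, T (vadd x y) = vadd (T x) (T y)) /\
  (forall a x, T (vscal a x) = vscal a (T x)).

Definition is_bounded_op {X : CBanach} (T : X -> X) : Prop :=
  is_linear_op T /\ exists M : R, forall x, vnorm (T x) <= M * vnorm x.

Definition is_bounded_functional {X : CBanach} (phi : X -> Cplx) : Prop :=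
  (forall x y, phi (vadd x y) = Cadd (phi x) (phi y)) /\
  (forall a x, phi (vscal a x) = Cmul a (phi x)) /\
  exists M : R, forall x, Cmod (phi x) <= M * vnorm x.

Definition is_semigroup {X : CBanach} (S : (X -> X) -> Prop) : Prop :=
  (forall T, S T -> is_bounded_op T) /\
  (forall T U, S T -> S U -> S (fun x => T (U x))).

Definition commutator {X : CBanach} (S T : X -> X) : X -> X :=
  fun x => vsub (S (T x)) (T (S x)).

Definition rank_le1 {X : CBanach} (T : X -> X) : Prop :=
  exists v : X, forall x, exists c : Cplx, T x = vscal c v.

Definition tensor_op {X : CBanach} (y : X) (phi : X -> Cplx) : X -> X :=
  fun x => vscal (phi x) y.

(* Main.v *)
From Stdlib Require Import Reals Lra Field Classical IndefiniteDescription.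
Require Import Defs.

(** If [P,Q] = u ⊗ f and [P,T] = v ⊗ g, then [P,QT] = u ⊗ fT + Qv ⊗ g must have
    rank at most one, so Qv is a multiple of u or fT is a multiple of g.  Taking
    products of A and B only, this forces tr [A,B] = φ(y) = 0 (a statement with
    content in infinite dimension), and hence tr [A,BC] = 0 for A, B, C in the
    semigroup, which makes tr (C[A,B]) invariant under cyclic permutations.

    Suppose t = φ(Cy) is not 0.  Put (X1,X2,X3) = (A,B,C) and
    [X2,X3] = y1 ⊗ f1, [X3,X1] = y2 ⊗ f2, [X1,X2] = y3 ⊗ f3.  Then fi(yi) = 0 and
    fi(Xi yi) = t.  For i ≠ j, either Xj yj is a multiple of yi or fi Xi is a
    multiple of fj, and both give fj(yi) ≠ 0.  So the yi are pairwise independent,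
    and so are the fi; counting the six alternatives shows that, up to swapping
    two indices, Xi maps yi to the line of y(i+1) and fi to the line of f(i+1).
    Finally [X1,X2²] has rank at most one, so X2 y3 = 0 or f3 X2 = 0, and either
    one contradicts the independence. *)

Open Scope R_scope.

(** * Complex numbers as a field *)

Definition Copp (a : Cplx) : Cplx := mkC (- Re a) (- Im a).
Definition Csub (a b : Cplx) : Cplx := Cadd a (Copp b).
Definition Cinv (a : Cplx) : Cplx :=
  mkC (Re a / (Re a * Re a + Im a * Im a)) (- Im a / (Re a * Re a + Im a * Im a)).
Definition Cdiv (a b : Cplx) : Cplx := Cmul a (Cinv b).

Lemma Cplx_eq (a b : Cplx) : Re a = Re b -> Im a = Im b -> a = b.
Proof. destruct a, b; simpl; intros -> ->; reflexivity. Qed.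

Lemma Cplx_field : field_theory C0 C1 Cadd Cmul Csub Copp Cdiv Cinv (@eq Cplx).
Proof.
constructor; [constructor| | |]; intros; try reflexivity;
  try (apply Cplx_eq; simpl; ring).
- intros h; injection h; lra.
- assert (Re p * Re p + Im p * Im p <> 0).
  { intros h; apply H; apply Cplx_eq; simpl; nra. }
  apply Cplx_eq; simpl; field; assumption.
Qed.

Add Field Cplx_field_inst : Cplx_field.

Lemma Cmul_integral (a b : Cplx) : Cmul a b = C0 -> a = C0 \/ b = C0.
Proof.
intros h; destruct (classic (a = C0)) as [h0|h0]; [now left|right].
replace b with (Cmul (Cinv a) (Cmul a b)) by (field; exact h0).
rewrite h; ring.
Qed.

Lemma Cmul_neq0 (a b : Cplx) : a <> C0 -> b <> C0 -> Cmul a b <> C0.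
Proof. intros ha hb h; destruct (Cmul_integral _ _ h); auto. Qed.

Lemma Csub_eq0 (a b : Cplx) : Csub a b = C0 -> a = b.
Proof. intros h; replace a with (Cadd (Csub a b) b) by ring; rewrite h; ring. Qed.

Lemma Cmul_neq0_l (a b : Cplx) : Cmul a b <> C0 -> a <> C0.
Proof. intros h ->; apply h; ring. Qed.

Lemma Cmul_neq0_r (a b : Cplx) : Cmul a b <> C0 -> b <> C0.
Proof. intros h ->; apply h; ring. Qed.

(** * Linear algebra of vectors, linear forms and operators *)

Section VectorSpace.

Context {X : CBanach}.
Implicit Types (x y u v w : X) (a b c : Cplx).

Lemma vadd_0r x : vadd x vzero = x.
Proof. rewrite vadd_comm; apply vadd_0l. Qed.

Lemma vadd_cancel_l x y z : vadd x y = vadd x z -> y = z :> X.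
Proof.
intros h; rewrite <- (vadd_0l _ y), <- (vadd_0l _ z), <- (vadd_oppr _ x).
rewrite (vadd_comm _ x), <- !vadd_assoc, h; reflexivity.
Qed.

Lemma vsub_addl x y : vsub (vadd x y) x = y.
Proof.
unfold vsub; rewrite (vadd_comm _ x), <- vadd_assoc, vadd_oppr; apply vadd_0r.
Qed.

Lemma vsub_eq x y z : vsub x y = z -> x = vadd y z.
Proof.
intros <-; unfold vsub.
rewrite (vadd_comm _ x), vadd_assoc, vadd_oppr, vadd_0l; reflexivity.
Qed.

Lemma vscal_0 x : vscal C0 x = vzero.
Proof.
apply (vadd_cancel_l (vscal C0 x)); rewrite <- vscal_addl, vadd_0r.
f_equal; ring.
Qed.

Lemma vscal_0r a : vscal a (vzero : X) = vzero.
Proof.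
apply (vadd_cancel_l (vscal a vzero)); rewrite <- vscal_addr, !vadd_0r.
reflexivity.
Qed.

Lemma vscal_solve a x y : a <> C0 -> vscal a x = y -> x = vscal (Cinv a) y.
Proof.
intros ha <-; rewrite vscal_assoc.
replace (Cmul (Cinv a) a) with C1 by (field; exact ha).
rewrite vscal_1; reflexivity.
Qed.

Lemma vscal_eq0 a x : vscal a x = vzero -> a = C0 \/ x = vzero.
Proof.
intros h; destruct (classic (a = C0)) as [ha|ha]; [now left|right].
rewrite (vscal_solve _ _ _ ha h); apply vscal_0r.
Qed.

Lemma vscal_inj a b x : x <> vzero -> vscal a x = vscal b x -> a = b.
Proof.
intros hx h; apply Csub_eq0.
destruct (vscal_eq0 (Csub a b) x) as [h0|h0]; [|exact h0|contradiction].
unfold Csub; rewrite vscal_addl, h, <- vscal_addl.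
replace (Cadd b (Copp b)) with C0 by ring; apply vscal_0.
Qed.

Lemma vcomb_transpose a b c d u v :
  vadd (vscal a u) (vscal b v) = vadd (vscal c u) (vscal d v) ->
  vscal (Csub b d) v = vscal (Csub c a) u.
Proof.
intros h; apply (vadd_cancel_l (vadd (vscal a u) (vscal d v))).
transitivity (vadd (vscal a u) (vscal b v)).
- rewrite <- vadd_assoc, <- vscal_addl; do 2 f_equal; ring.
- rewrite h, (vadd_comm _ (vscal a u)), <- vadd_assoc, <- vscal_addl.
  rewrite (vadd_comm _ (vscal d v)); do 2 f_equal; ring.
Qed.

(** Continuity is left out because the forms extracted from commutators by choice are only shown to
    be linear. *)
Definition is_linear_form (f : X -> Cplx) : Prop :=
  (forall x y, f (vadd x y) = Cadd (f x) (f y)) /\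
  (forall a x, f (vscal a x) = Cmul a (f x)).

Lemma form_add f x y : is_linear_form f -> f (vadd x y) = Cadd (f x) (f y).
Proof. intros [h _]; apply h. Qed.

Lemma form_scal f a x : is_linear_form f -> f (vscal a x) = Cmul a (f x).
Proof. intros [_ h]; apply h. Qed.

Lemma form_0 f : is_linear_form f -> f vzero = C0.
Proof. intros hf; rewrite <- (vscal_0 vzero), (form_scal f) by exact hf; ring. Qed.

Lemma form_neq0 f x : is_linear_form f -> f x <> C0 -> x <> vzero.
Proof. intros hf hx ->; apply hx, form_0, hf. Qed.

Lemma is_linear_form_comb f g a b : is_linear_form f -> is_linear_form g ->
  is_linear_form (fun x => Cadd (Cmul a (f x)) (Cmul b (g x))).
Proof.
intros [fa fs] [ga gs]; split; intros; [rewrite fa, ga|rewrite fs, gs]; ring.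
Qed.

Lemma is_linear_form_opp f :
  is_linear_form f -> is_linear_form (fun x => Copp (f x)).
Proof. intros [fa fs]; split; intros; [rewrite fa|rewrite fs]; ring. Qed.

Lemma is_linear_form_comp f T :
  is_linear_form f -> is_linear_op T -> is_linear_form (fun x => f (T x)).
Proof.
intros [fa fs] [Ta Ts]; split; intros; [rewrite Ta, fa|rewrite Ts, fs];
  reflexivity.
Qed.

Lemma op_0 (T : X -> X) : is_linear_op T -> T vzero = vzero.
Proof. intros [_ h]; rewrite <- (vscal_0 vzero) at 1; rewrite h; apply vscal_0. Qed.

(** * Proportionality and operators of rank at most one *)

Definition vpar u v : Prop := exists k, u = vscal k v.
Definition fpar (f g : X -> Cplx) : Prop := exists k, forall x, f x = Cmul k (g x).

(** If [f] is not a multiple of [g], some [x1] makes the determinant of [f], [g] at [x0], [x1]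
    nonzero. The images of [x0] and [x1] lie on one line; eliminating its generator [w] leaves a
    linear relation between [u] and [v]. *)
Lemma rank_le1_sum (f g : X -> Cplx) u v x0 :
  rank_le1 (fun x => vadd (vscal (f x) u) (vscal (g x) v)) ->
  u <> vzero -> g x0 <> C0 -> vpar v u \/ fpar f g.
Proof.
intros [w hw] hu hg.
destruct (classic (exists x1, Cmul (f x1) (g x0) <> Cmul (f x0) (g x1)))
  as [[x1 hdet]|hno]; cycle 1.
{ right; exists (Cdiv (f x0) (g x0)); intros x.
  assert (h : Cmul (f x) (g x0) = Cmul (f x0) (g x)).
  { apply NNPP; intros h; apply hno; now exists x. }
  transitivity (Cdiv (Cmul (f x) (g x0)) (g x0)); [|rewrite h]; field; exact hg. }
left; destruct (hw x0) as [c0 h0], (hw x1) as [c1 h1].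
assert (h : vscal (Csub (Cmul c1 (g x0)) (Cmul c0 (g x1))) v
          = vscal (Csub (Cmul c0 (f x1)) (Cmul c1 (f x0))) u).
{ apply vcomb_transpose; rewrite <- !vscal_assoc, <- !vscal_addr, h0, h1.
  rewrite !vscal_assoc; f_equal; ring. }
destruct (classic (Csub (Cmul c1 (g x0)) (Cmul c0 (g x1)) = C0)) as [hz|hnz].
- rewrite hz, vscal_0 in h; symmetry in h.
  destruct (vscal_eq0 _ _ h) as [hz'|hz']; [|contradiction].
  (* Both coefficients of the relation vanish; eliminating [c1] from them leaves [c0] times the
     nonzero determinant. So the image of [x0] is zero, which already puts [v] on the line of
     [u]. *)
  assert (hc : c0 = C0).
  { destruct (Cmul_integral c0
      (Csub (Cmul (f x1) (g x0)) (Cmul (f x0) (g x1)))) as [hc|hc]; [|exact hc|].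
    - transitivity (Cadd (Cmul (g x0) (Csub (Cmul c0 (f x1)) (Cmul c1 (f x0))))
        (Cmul (f x0) (Csub (Cmul c1 (g x0)) (Cmul c0 (g x1))))); [ring|].
      rewrite hz, hz'; ring.
    - destruct hdet; apply Csub_eq0, hc. }
  subst c0; exists (Cmul (Cinv (g x0)) (Copp (f x0))).
  rewrite <- vscal_assoc; apply vscal_solve; [exact hg|].
  apply (vadd_cancel_l (vscal (f x0) u)); rewrite h0, vscal_0, <- vscal_addl.
  replace (Cadd (f x0) (Copp (f x0))) with C0 by ring.
  symmetry; apply vscal_0.
- apply (vscal_solve _ _ _ hnz) in h; rewrite vscal_assoc in h.
  eexists; exact h.
Qed.

Lemma rank_le1_tensor (T : X -> X) : is_linear_op T -> rank_le1 T ->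
  exists y f, is_linear_form f /\ forall x, T x = vscal (f x) y.
Proof.
intros [Ta Ts] [y hy].
destruct (classic (y = vzero)) as [->|hy0].
{ exists vzero, (fun _ => C0); split; [split; intros; ring|].
  intros x; destruct (hy x) as [c ->]; rewrite !vscal_0r; reflexivity. }
destruct (functional_choice _ hy) as [f hf].
exists y, f; repeat split; [| |exact hf]; intros; apply (vscal_inj _ _ _ hy0).
- rewrite vscal_addl, <- !hf; apply Ta.
- rewrite <- vscal_assoc, <- !hf; apply Ts.
Qed.

(* [P,Q] = y ⊗ f, written without subtraction. *)
Definition commutes_upto (P Q : X -> X) y (f : X -> Cplx) : Prop :=
  forall x, P (Q x) = vadd (Q (P x)) (vscal (f x) y).

Lemma commutes_upto_sym P Q y f :
  commutes_upto P Q y f -> commutes_upto Q P y (fun x => Copp (f x)).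
Proof.
intros h x; rewrite h, <- vadd_assoc, <- vscal_addl.
replace (Cadd (f x) (Copp (f x))) with C0 by ring.
rewrite vscal_0, vadd_0r; reflexivity.
Qed.

(** Both products send [y] to [ab y], so the commutator term [f(y) y] vanishes. *)
Lemma common_eigenvector P Q y f a b : is_linear_op P -> is_linear_op Q ->
  is_linear_form f -> commutes_upto P Q y f ->
  P y = vscal a y -> Q y = vscal b y -> f y = C0.
Proof.
intros [_ hP] [_ hQ] hf h hPy hQy.
specialize (h y); rewrite hPy, hQy, hP, hQ, hPy, hQy, !vscal_assoc in h.
destruct (vscal_eq0 (f y) y) as [h0|h0]; [|exact h0|rewrite h0; apply form_0, hf].
apply (vadd_cancel_l (vscal (Cmul a b) y)); rewrite <- h, vadd_0r; f_equal; ring.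
Qed.

(** Dual to [common_eigenvector]: applying [f] to the identity at [y] leaves [f(y)^2 = 0]. *)
Lemma common_eigenform P Q y f a b : is_linear_form f -> commutes_upto P Q y f ->
  (forall x, f (P x) = Cmul a (f x)) -> (forall x, f (Q x) = Cmul b (f x)) ->
  f y = C0.
Proof.
intros hf h hP hQ.
specialize (h y); apply (f_equal f) in h.
rewrite form_add, form_scal, hP, !hQ, hP in h by exact hf.
destruct (Cmul_integral (f y) (f y)) as [h0|h0]; [|exact h0..].
transitivity (Csub (Cadd (Cmul b (Cmul a (f y))) (Cmul (f y) (f y)))
  (Cmul a (Cmul b (f y)))); [ring|rewrite <- h; ring].
Qed.

End VectorSpace.

(** * Commutators in the semigroup and their traces *)

Section Semigroup.

Context {X : CBanach} (S : (X -> X) -> Prop).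
Hypothesis S_lin : forall T, S T -> is_linear_op T.
Hypothesis S_mul : forall T U, S T -> S U -> S (fun x => T (U x)).
Hypothesis S_rank : forall T U, S T -> S U -> rank_le1 (commutator T U).

Implicit Types (P Q T : X -> X) (f g : X -> Cplx) (u v y : X).

(** A nonzero [w] determines its coefficients uniquely, so the chosen function [f] inherits
    linearity from the commutator; for [w = 0] the zero form serves. *)
Lemma S_commutator P Q : S P -> S Q ->
  exists y f, is_linear_form f /\ commutes_upto P Q y f.
Proof.
intros hP hQ; destruct (S_lin _ hP) as [Pa Ps], (S_lin _ hQ) as [Qa Qs].
destruct (S_rank P Q hP hQ) as [w hw].
destruct (classic (w = vzero)) as [->|hw0].
{ exists vzero, (fun _ => C0); split; [split; intros; ring|].
  intros x; apply vsub_eq; destruct (hw x) as [c hc].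
  unfold commutator in hc; rewrite hc, !vscal_0r; reflexivity. }
destruct (functional_choice _ hw) as [f hf].
assert (h : commutes_upto P Q w f) by (intros x; apply vsub_eq, hf).
exists w, f; split; [split|exact h].
- intros x y; apply (vscal_inj _ _ _ hw0).
  apply (vadd_cancel_l (Q (P (vadd x y)))); rewrite <- h.
  rewrite Qa, Pa, !h, Pa, Qa, vscal_addl.
  rewrite <- !vadd_assoc; f_equal; rewrite !vadd_assoc; f_equal; apply vadd_comm.
- intros a x; apply (vscal_inj _ _ _ hw0).
  apply (vadd_cancel_l (Q (P (vscal a x)))); rewrite <- h.
  rewrite Qs, Ps, h, Ps, Qs, vscal_addr, vscal_assoc; reflexivity.
Qed.

(** This is the Leibniz rule [[P,QT] = [P,Q]T + Q[P,T]]. *)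
Lemma commutes_upto_mul P Q T u v f g x : is_linear_op Q ->
  commutes_upto P Q u f -> commutes_upto P T v g ->
  P (Q (T x)) = vadd (Q (T (P x))) (vadd (vscal (f (T x)) u) (vscal (g x) (Q v))).
Proof.
intros [Qa Qs] hQ hT; rewrite hQ, hT, Qa, Qs, <- vadd_assoc; f_equal.
apply vadd_comm.
Qed.

Lemma commutator_mul_par P Q T u v f g x0 : S P -> S Q -> S T ->
  commutes_upto P Q u f -> commutes_upto P T v g -> u <> vzero -> g x0 <> C0 ->
  vpar (Q v) u \/ fpar (fun x => f (T x)) g.
Proof.
intros hP hQ hT cQ cT hu hg; apply (rank_le1_sum _ _ _ _ x0); [|exact hu|exact hg].
destruct (S_rank _ _ hP (S_mul _ _ hQ hT)) as [w hw]; exists w; intros x.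
destruct (hw x) as [c hc]; exists c; rewrite <- hc; unfold commutator.
rewrite (commutes_upto_mul P Q T u v f g) by auto; symmetry; apply vsub_addl.
Qed.

(** If [f(y)] is nonzero, then [[P,Q^2] = w ⊗ f] with [w = Qy + by], and [w] is nonzero since [y]
    cannot be a common eigenvector. The rank condition on [[Q^2,P^2]] makes [w] an eigenvector of
    [P] or [f] an eigenform of [P]. As [Pw = aw + f(y)y], the former puts [w], hence [Qy], on the
    line of [y]; the latter makes [f] a common eigenform. *)
Lemma trace_mixed P Q y f a b : S P -> S Q -> is_linear_form f ->
  commutes_upto P Q y f -> P y = vscal a y ->
  (forall x, f (Q x) = Cmul b (f x)) -> f y = C0.
Proof.
intros hP hQ hf h hPy hfQ; apply NNPP; intros hne.
pose proof (S_lin _ hP) as lP; pose proof (S_lin _ hQ) as lQ.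
set (w := vadd (Q y) (vscal b y)).
assert (noev : forall k, Q y <> vscal k y).
{ intros k hk; apply hne, (common_eigenvector P Q y f a k); auto. }
assert (hw : w <> vzero).
{ intros hw; apply (noev (Copp b)); apply (vadd_cancel_l (vscal b y)).
  rewrite (vadd_comm _ _ (Q y)); fold w; rewrite hw, <- vscal_addl.
  replace (Cadd b (Copp b)) with C0 by ring; symmetry; apply vscal_0. }
assert (cw : commutes_upto P (fun x => Q (Q x)) w f).
{ intros x; rewrite (commutes_upto_mul P Q Q y y f f) by auto; f_equal.
  unfold w; rewrite hfQ, vscal_addr, vscal_assoc, vadd_comm; do 2 f_equal; ring. }
apply commutes_upto_sym in cw.
destruct (commutator_mul_par (fun x => Q (Q x)) P P w w
  (fun x => Copp (f x)) (fun x => Copp (f x)) y) as [[k hk]|[k hk]]; auto.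
- intros h0; apply hne; replace (f y) with (Copp (Copp (f y))) by ring.
  rewrite h0; ring.
- assert (e : vscal (f y) y = vscal (Csub k a) w).
  { assert (hPw : P w = vadd (vscal a w) (vscal (f y) y)).
    { unfold w; destruct lP as [Pa Ps], lQ as [Qa Qs].
      rewrite Pa, Ps, h, hPy, Qs, vscal_addr, !vscal_assoc, <- !vadd_assoc.
      f_equal; rewrite vadd_comm; do 2 f_equal; ring. }
    apply (vadd_cancel_l (vscal a w)); rewrite <- hPw, hk, <- vscal_addl.
    f_equal; ring. }
  destruct (classic (Csub k a = C0)) as [hka|hka].
  { rewrite hka, vscal_0 in e; destruct (vscal_eq0 _ _ e) as [e0|e0]; [auto|].
    revert e0; apply (form_neq0 f); auto. }
  symmetry in e; apply (vscal_solve _ _ _ hka) in e; rewrite vscal_assoc in e.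
  apply (noev (Csub (Cmul (Cinv (Csub k a)) (f y)) b)).
  apply (vadd_cancel_l (vscal b y)); rewrite (vadd_comm _ _ (Q y)); fold w.
  rewrite e, <- vscal_addl; f_equal; ring.
- apply hne, (common_eigenform P Q y f k b); auto.
  intros x; replace (f (P x)) with (Copp (Copp (f (P x)))) by ring.
  rewrite hk; ring.
Qed.

(** The rank conditions on [[P,Q^2]] and [[Q,P^2]] each offer an eigenvector [y] or an eigenform
    [f]. Equal choices give a common eigenvector or eigenform; the two unequal ones are
    [trace_mixed] with either order of [P] and [Q]. *)
Lemma commutator_trace P Q y f : S P -> S Q -> is_linear_form f ->
  commutes_upto P Q y f -> f y = C0.
Proof.
intros hP hQ hf h; apply NNPP; intros hne.
pose proof (commutes_upto_sym _ _ _ _ h) as h'.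
pose proof (form_neq0 _ _ hf hne) as hy.
assert (hne' : Copp (f y) <> C0).
{ intros h0; apply hne; replace (f y) with (Copp (Copp (f y))) by ring.
  rewrite h0; ring. }
destruct (commutator_mul_par P Q Q y y f f y) as [[b hb]|[b hb]]; auto;
destruct (commutator_mul_par Q P P y y _ _ y hQ hP hP h' h' hy hne')
  as [[a ha]|[a ha]].
- apply hne, (common_eigenvector P Q y f a b); auto.
- apply hne', (trace_mixed Q P y (fun x => Copp (f x)) b a); auto.
  apply is_linear_form_opp, hf.
- apply hne, (trace_mixed P Q y f a b); auto.
- apply hne, (common_eigenform P Q y f a b); auto.
  intros x; replace (f (P x)) with (Copp (Copp (f (P x)))) by ring.
  rewrite ha; ring.
Qed.

(** The left side is the trace of [[P,QT]] read off its Leibniz expansion. In every case that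
    expansion collapses to a single tensor, whose trace vanishes by [commutator_trace]. *)
Lemma commutator_mul_trace P Q T u v f g : S P -> S Q -> S T ->
  is_linear_form f -> is_linear_form g ->
  commutes_upto P Q u f -> commutes_upto P T v g ->
  Cadd (f (T u)) (g (Q v)) = C0.
Proof.
intros hP hQ hT hf hg cQ cT.
pose proof (S_lin _ hQ) as lQ; pose proof (S_lin _ hT) as lT.
assert (hfT := is_linear_form_comp f T hf lT).
assert (key : forall y h, is_linear_form h ->
  (forall x, vscal (h x) y = vadd (vscal (f (T x)) u) (vscal (g x) (Q v))) ->
  h y = C0).
{ intros y h hh hx; apply (commutator_trace P (fun x => Q (T x))); auto.
  intros x; rewrite hx; apply commutes_upto_mul; auto. }
destruct (classic (u = vzero)) as [->|hu].
{ rewrite (op_0 T), (form_0 f), (key (Q v) g) by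
    (try assumption; intros; rewrite vscal_0r, vadd_0l; reflexivity); ring. }
destruct (classic (exists x0, g x0 <> C0)) as [[x0 hx0]|hno]; cycle 1.
{ assert (hg0 : forall x, g x = C0).
  { intros x; apply NNPP; intros h; apply hno; now exists x. }
  rewrite hg0, (key u (fun x => f (T x)) hfT); [ring|].
  intros x; rewrite hg0, vscal_0, vadd_0r; reflexivity. }
destruct (commutator_mul_par P Q T u v f g x0) as [[k hk]|[k hk]]; auto.
- rewrite hk, form_scal by exact hg.
  rewrite <- (key u (fun x => Cadd (Cmul C1 (f (T x))) (Cmul k (g x)))).
  + ring.
  + apply is_linear_form_comb; auto.
  + intros x; rewrite hk, vscal_addl, vscal_assoc; f_equal; f_equal; ring.
- rewrite hk, <- (key (vadd (vscal k u) (Q v)) g hg).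
  + rewrite form_add, form_scal by exact hg; ring.
  + intros x; rewrite hk, vscal_addr, vscal_assoc; do 2 f_equal; ring.
Qed.

(** * Cyclic triples: the configuration to be refuted *)

Record triple (X1 X2 X3 : X -> X) (y1 y2 y3 : X) (f1 f2 f3 : X -> Cplx) : Prop := {
  tr_S1 : S X1; tr_S2 : S X2; tr_S3 : S X3;
  tr_f1 : is_linear_form f1; tr_f2 : is_linear_form f2; tr_f3 : is_linear_form f3;
  tr_c1 : commutes_upto X2 X3 y1 f1;
  tr_c2 : commutes_upto X3 X1 y2 f2;
  tr_c3 : commutes_upto X1 X2 y3 f3;
  tr_neq0 : f3 (X3 y3) <> C0
}.

(** The difference of the two sides is the trace of [[X1, X2 X3]], since [[X1,X3] = y2 ⊗ (-f2)]. *)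
Lemma triple_cyclic_trace X1 X2 X3 y1 y2 y3 f1 f2 f3 :
  triple X1 X2 X3 y1 y2 y3 f1 f2 f3 -> f3 (X3 y3) = f2 (X2 y2).
Proof.
intros []; apply Csub_eq0.
rewrite <- (commutator_mul_trace X1 X2 X3 y3 y2 f3 (fun x => Copp (f2 x)));
  auto using is_linear_form_opp, commutes_upto_sym.
Qed.

Lemma triple_rot X1 X2 X3 y1 y2 y3 f1 f2 f3 :
  triple X1 X2 X3 y1 y2 y3 f1 f2 f3 -> triple X3 X1 X2 y3 y1 y2 f3 f1 f2.
Proof.
intros h; pose proof (triple_cyclic_trace _ _ _ _ _ _ _ _ _ h) as e.
destruct h; split; auto; rewrite <- e; assumption.
Qed.

Lemma triple_swap X1 X2 X3 y1 y2 y3 f1 f2 f3 :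
  triple X1 X2 X3 y1 y2 y3 f1 f2 f3 ->
  triple X2 X1 X3 y2 y1 y3 (fun x => Copp (f2 x)) (fun x => Copp (f1 x))
    (fun x => Copp (f3 x)).
Proof.
intros []; split; auto using is_linear_form_opp, commutes_upto_sym.
intros h; apply tr_neq1.
replace (f3 (X3 y3)) with (Copp (Copp (f3 (X3 y3)))) by ring; rewrite h; ring.
Qed.

Lemma triple_self_pairing X1 X2 X3 y1 y2 y3 f1 f2 f3 :
  triple X1 X2 X3 y1 y2 y3 f1 f2 f3 -> f3 y3 = C0.
Proof. intros []; apply (commutator_trace X1 X2); auto. Qed.

(** This is the rank dichotomy for [[X1, X2 X3]]; cyclic invariance shows that [f2] does not vanish
    at the witness [X2 y2]. *)
Lemma triple_alternative X1 X2 X3 y1 y2 y3 f1 f2 f3 :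
  triple X1 X2 X3 y1 y2 y3 f1 f2 f3 ->
  vpar (X2 y2) y3 \/ fpar (fun x => f3 (X3 x)) f2.
Proof.
intros h; pose proof (triple_cyclic_trace _ _ _ _ _ _ _ _ _ h) as e; destruct h.
destruct (commutator_mul_par X1 X2 X3 y3 y2 f3 (fun x => Copp (f2 x)) (X2 y2))
  as [h|[k h]]; auto using commutes_upto_sym.
- apply (form_neq0 (fun x => f3 (X3 x))); auto using is_linear_form_comp.
- intros h; apply tr_neq1; rewrite e.
  replace (f2 (X2 y2)) with (Copp (Copp (f2 (X2 y2)))) by ring; rewrite h; ring.
- right; exists (Copp k); intros x; rewrite h; ring.
Qed.

Lemma triple_cross_pairing X1 X2 X3 y1 y2 y3 f1 f2 f3 :
  triple X1 X2 X3 y1 y2 y3 f1 f2 f3 -> f2 y3 <> C0.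
Proof.
intros h; pose proof (triple_cyclic_trace _ _ _ _ _ _ _ _ _ h) as e.
pose proof (triple_alternative _ _ _ _ _ _ _ _ _ h) as [[k hk]|[k hk]]; destruct h.
- rewrite e, hk, form_scal in tr_neq1 by assumption.
  exact (Cmul_neq0_r _ _ tr_neq1).
- rewrite hk in tr_neq1; exact (Cmul_neq0_r _ _ tr_neq1).
Qed.

Lemma fpar_opp f g :
  fpar (fun x => Copp (f x)) (fun x => Copp (g x)) -> fpar f g.
Proof.
intros [k h]; exists k; intros x.
replace (f x) with (Copp (Copp (f x))) by ring; rewrite h; ring.
Qed.

(** Together with the rotations, this says that the matrix of the [fi(yj)] is zero exactly on its
    diagonal, which yields all the independence used below. *)
Lemma triple_pairings X1 X2 X3 y1 y2 y3 f1 f2 f3 :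
  triple X1 X2 X3 y1 y2 y3 f1 f2 f3 ->
  f3 y3 = C0 /\ f2 y3 <> C0 /\ f1 y3 <> C0.
Proof.
intros h; repeat split.
- eapply triple_self_pairing, h.
- eapply triple_cross_pairing, h.
- intros h0; apply (triple_cross_pairing _ _ _ _ _ _ _ _ _ (triple_swap _ _ _ _ _ _ _ _ _ h)).
  rewrite h0; ring.
Qed.

(** Each conclusion is one branch of an alternative. The other branch would put [X2 y2] on the lines
    of both [y3] and [y1], or [f1 X1] on those of both [f2] and [f3]; independence would make it
    zero, although [f2(X2 y2)] and [f1(X1 y1)] are nonzero. *)
Lemma triple_orientation_step X1 X2 X3 y1 y2 y3 f1 f2 f3 :
  triple X1 X2 X3 y1 y2 y3 f1 f2 f3 -> vpar (X2 y2) y3 ->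
  fpar (fun x => f1 (X1 x)) f2 /\ vpar (X3 y3) y1.
Proof.
intros h [k hk].
pose proof (triple_rot _ _ _ _ _ _ _ _ _ h) as h'.
pose proof (triple_rot _ _ _ _ _ _ _ _ _ h') as h''.
pose proof (triple_pairings _ _ _ _ _ _ _ _ _ h) as (p33 & p23 & p13).
pose proof (triple_pairings _ _ _ _ _ _ _ _ _ h'') as (p11 & _ & _).
pose proof (tr_neq0 _ _ _ _ _ _ _ _ _ h') as t2.
pose proof (tr_neq0 _ _ _ _ _ _ _ _ _ h'') as t1.
assert (G12 : fpar (fun x => f1 (X1 x)) f2).
{ destruct (triple_alternative _ _ _ _ _ _ _ _ _
    (triple_rot _ _ _ _ _ _ _ _ _ (triple_swap _ _ _ _ _ _ _ _ _ h)))
    as [[k' hk']|hG]; [exfalso|exact (fpar_opp _ _ hG)].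
  assert (e : Cmul k (f1 y3) = C0).
  { rewrite <- form_scal, <- hk, hk', form_scal, p11 by apply h; ring. }
  destruct (Cmul_integral _ _ e) as [->|e0]; [|contradiction].
  apply t2; rewrite hk, form_scal by apply h; ring. }
split; [exact G12|].
destruct (triple_alternative _ _ _ _ _ _ _ _ _ h'') as [F13|[k' hk']];
  [exact F13|exfalso].
destruct G12 as [l hl].
assert (e : Cmul l (f2 y3) = C0) by (rewrite <- hl, hk', p33; ring).
destruct (Cmul_integral _ _ e) as [->|e0]; [|contradiction].
apply t1; rewrite hl; ring.
Qed.

Lemma oriented_triple_absurd X1 X2 X3 y1 y2 y3 f1 f2 f3 :
  triple X1 X2 X3 y1 y2 y3 f1 f2 f3 -> vpar (X2 y2) y3 -> False.
Proof.
intros h F32.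
pose proof (triple_rot _ _ _ _ _ _ _ _ _ h) as h'.
pose proof (triple_rot _ _ _ _ _ _ _ _ _ h') as h''.
(* Each step yields the hypothesis of the next rotation, so the orientation travels around the whole
   cycle. *)
pose proof (triple_orientation_step _ _ _ _ _ _ _ _ _ h F32) as [[b1 G12] F13].
pose proof (triple_orientation_step _ _ _ _ _ _ _ _ _ h'' F13) as [[b2 G23] F21].
pose proof (triple_orientation_step _ _ _ _ _ _ _ _ _ h' F21) as [[b3 G31] _].
destruct F32 as [a2 F32], F13 as [a3 F13], F21 as [a1 F21].
pose proof (triple_pairings _ _ _ _ _ _ _ _ _ h) as (p33 & p23 & p13).
pose proof (triple_pairings _ _ _ _ _ _ _ _ _ h') as (p22 & p12 & p32).
pose proof (triple_pairings _ _ _ _ _ _ _ _ _ h'') as (p11 & p31 & p21).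
pose proof (tr_neq0 _ _ _ _ _ _ _ _ _ h'') as t1.
destruct h as [S1 S2 S3 l1 l2 l3 c1 c2 c3 _].
destruct (S_lin _ S1) as [_ X1s], (S_lin _ S2) as [_ X2s].
pose proof (S_lin _ S3) as X3l.
(* The rank condition on [[X1, X2^2]] gives [X2 y3 = k y3] or [f3 X2 = k f3]; pairing with [f2],
   respectively evaluating at [y2], forces [k = 0]. *)
destruct (commutator_mul_par X1 X2 X2 y3 y3 f3 f3 y2) as [[k hk]|[k hk]]; auto.
- apply (form_neq0 f2); auto.
- assert (e : Cmul k (f2 y3) = C0).
  { rewrite <- form_scal, <- hk, G23, p33 by exact l2; ring. }
  destruct (Cmul_integral _ _ e) as [->|e0]; [|contradiction].
  rewrite vscal_0 in hk.
  (* With [X2 y3 = 0], this reads [a3 X2 y1 = f1(y3) y1]. Applying [f3 X1] kills the left side,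
     because [X1 X2 y1] lies on the line of [y3], but gives [f1(y3) a1 f3(y2)] on the right. *)
  pose proof (c1 y3) as e1.
  rewrite hk, (op_0 X3 X3l), vadd_0l, F13, X2s in e1.
  apply (f_equal X1), (f_equal f3) in e1.
  rewrite !X1s, F21, !form_scal in e1 by exact l3.
  pose proof (f_equal f3 (c3 y1)) as e3.
  rewrite F21, X2s, F32, form_add, !form_scal, p33 in e3 by exact l3.
  assert (e4 : Cmul (f1 y3) (Cmul a1 (f3 y2)) = C0) by (rewrite <- e1, e3; ring).
  revert e4; repeat apply Cmul_neq0; auto.
  rewrite F21, form_scal in t1 by exact l1; exact (Cmul_neq0_l _ _ t1).
- assert (e : Cmul k (f3 y2) = C0).
  { rewrite <- hk, F32, form_scal, p33 by exact l3; ring. }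
  destruct (Cmul_integral _ _ e) as [->|e0]; [|contradiction].
  (* Here [f3 X2 = 0]. This identity gives [f1(X2 X1 y3) = 0]; then [f3] applied to [[X2,X3]] at
     [X1 y3] leaves [b1 f2(y3) f3(y1) = 0], a product of nonzero factors. *)
  pose proof (f_equal f1 (c3 y3)) as e3.
  rewrite G12, G23, p33, form_add, form_scal in e3 by exact l1.
  pose proof (f_equal f3 (c1 (X1 y3))) as e1.
  rewrite hk, form_add, form_scal, !G31, G12 in e1 by exact l3.
  assert (z : f1 (X2 (X1 y3)) = C0).
  { transitivity (Cadd (f1 (X2 (X1 y3))) (Cmul C0 (f1 y3))); [ring|].
    rewrite <- e3; ring. }
  assert (e4 : Cmul (Cmul b1 (f2 y3)) (f3 y1) = C0).
  { rewrite z in e1.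
    transitivity (Cadd (Cmul b3 C0) (Cmul (Cmul b1 (f2 y3)) (f3 y1))); [ring|].
    rewrite <- e1; ring. }
  revert e4; repeat apply Cmul_neq0; auto.
  rewrite G12 in t1; exact (Cmul_neq0_l _ _ t1).
Qed.

(** Unless the triple or its swap is oriented, [f3 X3] is a multiple of both [f2] and [f1];
    evaluation at [y1] then makes it zero, against [tr_neq0]. *)
Lemma triple_absurd X1 X2 X3 y1 y2 y3 f1 f2 f3 :
  ~ triple X1 X2 X3 y1 y2 y3 f1 f2 f3.
Proof.
intros h.
pose proof (triple_swap _ _ _ _ _ _ _ _ _ h) as hs.
destruct (triple_alternative _ _ _ _ _ _ _ _ _ h) as [F32|[k G32]];
  [exact (oriented_triple_absurd _ _ _ _ _ _ _ _ _ h F32)|].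
destruct (triple_alternative _ _ _ _ _ _ _ _ _ hs) as [F31|G31];
  [exact (oriented_triple_absurd _ _ _ _ _ _ _ _ _ hs F31)|].
apply fpar_opp in G31; destruct G31 as [l G31].
pose proof (triple_rot _ _ _ _ _ _ _ _ _ (triple_rot _ _ _ _ _ _ _ _ _ h)) as h''.
pose proof (triple_pairings _ _ _ _ _ _ _ _ _ h'') as (p11 & _ & p21).
assert (e : Cmul k (f2 y1) = C0) by (rewrite <- G32, G31, p11; ring).
destruct (Cmul_integral _ _ e) as [->|e0]; [|contradiction].
apply (tr_neq0 _ _ _ _ _ _ _ _ _ h); rewrite G32; ring.
Qed.

End Semigroup.

Theorem mainTheorem1 (X : CBanach) (hdim : dim_ge2 X)
  (S : (X -> X) -> Prop) (hS : is_semigroup S)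
  (hrank : forall T U, S T -> S U -> rank_le1 (commutator T U))
  (A B : X -> X) (hA : S A) (hB : S B)
  (y : X) (phi : X -> Cplx) (hphi : is_bounded_functional phi)
  (hy : y <> vzero) (hphi0 : exists x, phi x <> C0)
  (hAB : forall x, commutator A B x = tensor_op y phi x) :
  forall C : X -> X, (S C \/ (forall x, C x = x)) -> phi (C y) = C0.
Proof.
destruct hS as [hbd hmul].
assert (hlin : forall T, S T -> is_linear_op T) by (intros T hT; apply (hbd T hT)).
assert (lphi : is_linear_form phi) by (destruct hphi as (h1 & h2 & _); now split).
assert (cAB : commutes_upto A B y phi) by (intros x; apply vsub_eq, hAB).
intros C [hC|hC].
- apply NNPP; intros hne.
  destruct (S_commutator S hlin hrank B C hB hC) as (y1 & f1 & l1 & c1).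
  destruct (S_commutator S hlin hrank C A hC hA) as (y2 & f2 & l2 & c2).
  apply (triple_absurd S hlin hmul hrank A B C y1 y2 y f1 f2 phi).
  split; assumption.
- rewrite hC; apply (commutator_trace S hlin hmul hrank A B); assumption.
Qed.
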